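(* Let $p,q\in\mathrm{End}(\mathbb N)$ be the untyped quasi-projections and $p^\ddag,q^\ddag\in\mathrm{End}(\mathbb N)$ the untyped quasi-injections. Then $$pp^\ddag=1_{\mathbb N}=qq^\ddag \quad\text{and}\quad pq^\ddag=0_{\mathbb N}=qp^\ddag .$$ Further, with respect to the natural partial order on $\mathrm{End}(\mathbb N)$, $$p^\ddag p\vee q^\ddag q=1_{\mathbb N}.$$
   Context: $\mathbb N=\{0,1,2,\dots\}$. $\mathrm{End}(\mathbb N)$ is the monoid of partial injections $\mathbb N\to\mathbb N$ (partial functions that are injective on their domain of definition), with $gf$ meaning ''first $f$, then $g$''; $1_{\mathbb N}$ is the identity and $0_{\mathbb N}$ is the nowhere-defined partial function. For a partial injection $f:X\to Y$, its generalised inverse $f^\ddag:Y\to X$ is the partial injection with $f^\ddag(y)=x$ if and only if $f(x)=y$. The natural partial order on $\mathrm{End}(\mathbb N)$ is: $f\unlhd g$ iff there is $e\in\mathrm{End}(\mathbb N)$ with $e^2=e$ and $f=ge$. The symbol $\vee$ denotes the join (least upper bound) with respect to $\unlhd$. $\mathbb N\uplus\mathbb N=\mathbb N\times\{0,1\}$. The quasi-projections $\pi_0,\pi_1:\mathbb N\uplus\mathbb N\to\mathbb N$ are the partial injections with $\pi_0(n,0)=n$, $\pi_0$ undefined on elements $(n,1)$; and $\pi_1(n,1)=n$, $\pi_1$ undefined on elements $(n,0)$. The Cantor pairing is the bijection $c:\mathbb N\uplus\mathbb N\to\mathbb N$, $c(n,i)=2n+i$, with inverse $d=c^{-1}$.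 The untyped quasi-projections are $p=\pi_0 d$ and $q=\pi_1 d$; the untyped quasi-injections are their generalised inverses $p^\ddag,q^\ddag$. *)

(* Defs.v *)
From mathcomp Require Import all_boot.
From mathcomp Require Import boolp.

Set Implicit Arguments.
Unset Strict Implicit.
Unset Printing Implicit Defensive.

(* Partial functions are maps into an option type, [None] meaning "undefined". *)
Record pinj (X Y : Type) : Type := PInj {
  pinj_fun :> X -> option Y;
  pinj_injective : forall x x' y,
    pinj_fun x = Some y -> pinj_fun x' = Some y -> x = x'
}.

Lemma pinj_eq X Y (f g : pinj X Y) : (forall x, f x = g x) -> f = g.
Proof.
case: f g => [f fI] [g gI] /= /funext fg.
by move: fI gI; rewrite fg => fI gI; congr PInj; apply: Prop_irrelevance.
Qed.

Lemma pinj_comp_subproof X Y Z (g : pinj Y Z) (f : pinj X Y) x x' z :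
  pcomp g f x = Some z -> pcomp g f x' = Some z -> x = x'.
Proof.
rewrite /pcomp; case fx: (f x) => [y|] //= gy.
case fx': (f x') => [y'|] //= gy'.
by move: fx'; rewrite (pinj_injective gy' gy); apply: pinj_injective.
Qed.

(* [g *p f] is "first f, then g". *)
Definition pinj_comp X Y Z (g : pinj Y Z) (f : pinj X Y) : pinj X Z :=
  PInj (@pinj_comp_subproof X Y Z g f).

Notation "g *p f" := (pinj_comp g f) (at level 40, left associativity).

Lemma pinj_total_subproof X Y (f : X -> Y) (fI : injective f) x x' y :
  Some (f x) = Some y -> Some (f x') = Some y -> x = x'.
Proof. by move=> [<-] [/fI]. Qed.

Definition pinj_total X Y (f : X -> Y) (fI : injective f) : pinj X Y :=
  PInj (pinj_total_subproof fI).

Definition pinj_id X : pinj X X := pinj_total (@inj_id X).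

Lemma pinj_zero_subproof X Y (x x' : X) (y : Y) :
  None = Some y -> None = Some y -> x = x'.
Proof. by []. Qed.

Definition pinj_zero X Y : pinj X Y := PInj (@pinj_zero_subproof X Y).

Definition ginv_fun X Y (f : pinj X Y) (y : Y) : option X :=
  if pselect (exists x, f x = Some y) is left fy then Some (sval (cid fy))
  else None.

Lemma ginv_funP X Y (f : pinj X Y) x y :
  ginv_fun f y = Some x <-> f x = Some y.
Proof.
rewrite /ginv_fun; case: pselect => [fy|nfy].
  case: cid => x' /= fx'; split=> [[<-] //|fx].
  by rewrite (pinj_injective fx' fx).
by split=> // fx; case: nfy; exists x.
Qed.

Lemma ginv_subproof X Y (f : pinj X Y) y y' x :
  ginv_fun f y = Some x -> ginv_fun f y' = Some x -> y = y'.
Proof. by move=> /ginv_funP fx /ginv_funP; rewrite fx => -[]. Qed.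

Definition ginv X Y (f : pinj X Y) : pinj Y X := PInj (@ginv_subproof X Y f).

Lemma ginvP X Y (f : pinj X Y) x y : ginv f y = Some x <-> f x = Some y.
Proof. exact: ginv_funP. Qed.

Definition natural_le X (f g : pinj X X) : Prop :=
  exists e : pinj X X, e *p e = e /\ f = g *p e.

Lemma natural_leP X (f g : pinj X X) :
  natural_le f g <-> forall x y, f x = Some y -> g x = Some y.
Proof.
split=> [[e [ee ->]] x y|fg].
  rewrite /= /pcomp; case ex: (e x) => [z|] //= gz.
  have := congr1 (fun h : pinj X X => h x) ee; rewrite /= /pcomp ex /= => ez.
  by rewrite (pinj_injective ex ez).
have eI x x' y : (if f x is Some _ then Some x else None) = Some y ->
   (if f x' is Some _ then Some x' else None) = Some y -> x = x'.
  by case: (f x) => // _ [->]; case: (f x') => // _ [->].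
exists (PInj eI); split; apply: pinj_eq => x /=; rewrite /pcomp /=; case fx: (f x) => [y|] //=.
  by rewrite fx.
by rewrite (fg _ _ fx).
Qed.

Lemma natural_le_anti X (f g : pinj X X) : natural_le f g -> natural_le g f -> f = g.
Proof.
move=> /natural_leP fg /natural_leP gf; apply: pinj_eq => x.
case fx: (f x) => [y|]; first by rewrite (fg _ _ fx).
by case gx: (g x) => [y|] //; rewrite -fx (gf _ _ gx).
Qed.

Definition is_join X (f g h : pinj X X) : Prop :=
  [/\ natural_le f h, natural_le g h &
      forall k, natural_le f k -> natural_le g k -> natural_le h k].

Lemma is_join_unique X (f g h h' : pinj X X) :
  is_join f g h -> is_join f g h' -> h = h'.
Proof.
by move=> [fh gh hP] [fh' gh' hP']; apply: natural_le_anti; [apply: hP|apply: hP'].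
Qed.

(* The disjoint union N x {0,1} is [nat * bool], with false = 0, true = 1. *)
Definition quasi_proj0_fun (u : nat * bool) : option nat :=
  if u.2 then None else Some u.1.

Definition quasi_proj1_fun (u : nat * bool) : option nat :=
  if u.2 then Some u.1 else None.

Lemma quasi_proj0_subproof u v n :
  quasi_proj0_fun u = Some n -> quasi_proj0_fun v = Some n -> u = v.
Proof. by case: u v => [a []] [b []] //= [->] [->]. Qed.

Lemma quasi_proj1_subproof u v n :
  quasi_proj1_fun u = Some n -> quasi_proj1_fun v = Some n -> u = v.
Proof. by case: u v => [a []] [b []] //= [->] [->]. Qed.

Definition quasi_proj0 : pinj (nat * bool) nat := PInj quasi_proj0_subproof.
Definition quasi_proj1 : pinj (nat * bool) nat := PInj quasi_proj1_subproof.

Definition cantor (u : nat * bool) : nat := 2 * u.1 + u.2.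
Definition cantor_inv (m : nat) : nat * bool := (m./2, odd m).

Lemma cantorK : cancel cantor cantor_inv.
Proof.
case=> n i; rewrite /cantor /cantor_inv /= mul2n addnC half_bit_double.
by rewrite oddD odd_double addbF oddb.
Qed.

Lemma cantor_invK : cancel cantor_inv cantor.
Proof. by move=> m; rewrite /cantor /= mul2n addnC odd_double_half. Qed.

Definition untyped_p : pinj nat nat :=
  quasi_proj0 *p pinj_total (can_inj cantor_invK).
Definition untyped_q : pinj nat nat :=
  quasi_proj1 *p pinj_total (can_inj cantor_invK).

(* Main.v *)
Require Import Defs.
From mathcomp Require Import all_boot.

Set Implicit Arguments.
Unset Strict Implicit.
Unset Printing Implicit Defensive.

(** Each composite in the theorem is a partial identity or is empty, and which
    one depends only on domains and images.  For partial injections [f] and [g]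
    out of the same set, [f *p ginv f] is the identity on the image of [f],
    [ginv f *p f] is the identity on the domain of [f], and [f *p ginv g] is
    empty as soon as the domains of [f] and [g] are disjoint.  Here [p] halves
    the even numbers and [q] sends the odd number [2n + 1] to [n]: both are
    onto, and their domains, the evens and the odds, partition the natural
    numbers.  Disjointness gives the two zero equations
    ([pinj_comp_ginv_disjoint]), surjectivity the two identities
    ([pinj_comp_ginv_surj]).  The order [natural_le] is inclusion of graphs, so
    an upper bound of the partial identities on two sets that cover everything
    contains the full identity ([is_join_ginv_comp]). *)

Lemma pinj_comp_ginv_surj X Y (f : pinj X Y) :
  (forall y, exists x, f x = Some y) -> f *p ginv f = pinj_id Y.
Proof.
move=> f_surj; apply: pinj_eq => y; have [x fx] := f_surj y.
have fy : ginv f y = Some x by apply/ginvP.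
by rewrite [LHS]/= /pcomp [ginv_fun f y]fy.
Qed.

Lemma pinj_comp_ginv_disjoint X Y Z (f : pinj X Y) (g : pinj X Z) :
  (forall x z, g x = Some z -> f x = None) -> f *p ginv g = pinj_zero Z Y.
Proof.
move=> dis; apply: pinj_eq => z; rewrite [LHS]/= /pcomp.
by case gz: (ginv_fun g z) => [x|] //=; apply: (dis x z); apply/ginv_funP.
Qed.

Lemma ginv_comp_dom X Y (f : pinj X Y) x y :
  f x = Some y -> (ginv f *p f) x = Some x.
Proof. by move=> fx; rewrite /= /pcomp fx /=; apply/ginv_funP. Qed.

Lemma ginv_comp_le_id X Y (f : pinj X Y) :
  natural_le (ginv f *p f) (pinj_id X).
Proof.
apply/natural_leP => x x' /=; rewrite /pcomp.
case fx: (f x) => [y|] //= /ginv_funP fx'.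
by rewrite (pinj_injective fx fx').
Qed.

Lemma is_join_ginv_comp X Y Z (f : pinj X Y) (g : pinj X Z) :
  (forall x, f x = None -> exists z, g x = Some z) ->
  is_join (ginv f *p f) (ginv g *p g) (pinj_id X).
Proof.
move=> cover; split; try exact: ginv_comp_le_id.
move=> k /natural_leP fk /natural_leP gk; apply/natural_leP => x _ [<-].
case fx: (f x) => [y|]; first by apply: fk; apply: ginv_comp_dom fx.
by have [z gx] := cover x fx; apply: gk; apply: ginv_comp_dom gx.
Qed.

Lemma untyped_pE m : untyped_p m = if odd m then None else Some m./2.
Proof. by []. Qed.

Lemma untyped_qE m : untyped_q m = if odd m then Some m./2 else None.
Proof. by []. Qed.

Lemma untyped_p_surj n : exists m, untyped_p m = Some n.
Proof. by exists n.*2; rewrite untyped_pE odd_double doubleK. Qed.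

Lemma untyped_q_surj n : exists m, untyped_q m = Some n.
Proof. by exists n.*2.+1; rewrite untyped_qE /= odd_double uphalf_double. Qed.

Theorem proposition4p3 :
  (untyped_p *p ginv untyped_p = pinj_id nat /\
   untyped_q *p ginv untyped_q = pinj_id nat) /\
  (untyped_p *p ginv untyped_q = pinj_zero nat nat /\
   untyped_q *p ginv untyped_p = pinj_zero nat nat) /\
  is_join (ginv untyped_p *p untyped_p) (ginv untyped_q *p untyped_q)
          (pinj_id nat).
Proof.
split; [split | split; [split |]].
- exact: pinj_comp_ginv_surj untyped_p_surj.
- exact: pinj_comp_ginv_surj untyped_q_surj.
- apply: pinj_comp_ginv_disjoint => m n.
  by rewrite untyped_pE untyped_qE; case: odd.
- apply: pinj_comp_ginv_disjoint => m n.
  by rewrite untyped_pE untyped_qE; case: odd.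
- apply: is_join_ginv_comp => m.
  by rewrite untyped_pE untyped_qE; case: odd => // _; exists m./2.
Qed.
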